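(* If $G$ is a highly computable infinite graph with finitely many ends, then the set of finite words $v_0\dots v_n\in V(G)^\ast$ such that $v_0,\dots,v_n$ is a simple path in $G$ that can be extended to an infinite simple path $(v_n)_{n\in\mathbb{N}}$ is a decidable set. In particular, $G$ admits computable infinite simple paths.
   Context: Graphs are connected and locally finite. A graph $G$ is highly computable when $V(G)$ is a decidable subset of $\mathbb{N}$, the adjacency relation is decidable, $G$ is locally finite and the vertex degree function is computable. A path is simple when every vertex is visited at most once. The number of ends of a connected graph $G$ is the supremum, over all finite sets of edges $E\subset E(G)$, of the number of infinite connected components of $G\smallsetminus E$ (the subgraph induced by $E(G)\smallsetminus E$). *)

(* Defs.v *)
From mathcomp Require Import all_boot finmap.
From mathcomp Require Import boolp classical_sets cardinality.

Set Implicit Arguments.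
Unset Strict Implicit.
Unset Printing Implicit Defensive.

Local Open Scope classical_set_scope.

(** * Partial recursive functions *)

(* [rec_prec g h] recurses on the first argument and [rec_mu f] minimizes over
   the first argument. *)
Inductive recfun : nat -> Type :=
| rec_zero k : recfun k
| rec_succ : recfun 1
| rec_proj k (i : 'I_k) : recfun k
| rec_comp k m (g : recfun m) (h : 'I_m -> recfun k) : recfun k
| rec_prec k (g : recfun k) (h : recfun k.+2) : recfun k.+1
| rec_mu k (f : recfun k.+1) : recfun k.

(* [eval f v y] means that [f] is defined at [v] with value [y]. *)
Inductive eval : forall k, recfun k -> k.-tuple nat -> nat -> Prop :=
| eval_zero k (v : k.-tuple nat) : eval (rec_zero k) v 0
| eval_succ (n : nat) : eval rec_succ [tuple n] n.+1
| eval_proj k (i : 'I_k) (v : k.-tuple nat) : eval (rec_proj i) v (tnth v i)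
| eval_comp k m (g : recfun m) (h : 'I_m -> recfun k)
    (v : k.-tuple nat) (w : m.-tuple nat) (y : nat) :
    (forall i, eval (h i) v (tnth w i)) -> eval g w y ->
    eval (rec_comp g h) v y
| eval_prec0 k (g : recfun k) (h : recfun k.+2) (v : k.-tuple nat) (y : nat) :
    eval g v y -> eval (rec_prec g h) [tuple of 0 :: v] y
| eval_precS k (g : recfun k) (h : recfun k.+2) (v : k.-tuple nat)
    (n z y : nat) :
    eval (rec_prec g h) [tuple of n :: v] z ->
    eval h [tuple of n :: z :: v] y ->
    eval (rec_prec g h) [tuple of n.+1 :: v] y
| eval_mu k (f : recfun k.+1) (v : k.-tuple nat) (n : nat) (z : nat -> nat) :
    (forall m, m < n -> eval f [tuple of m :: v] (z m).+1) ->
    eval f [tuple of n :: v] 0 ->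
    eval (rec_mu f) v n.

Definition computable_on (D : set nat) (f : nat -> nat) : Prop :=
  exists c : recfun 1, forall n, D n -> eval c [tuple n] (f n).

Definition computable (f : nat -> nat) : Prop := computable_on setT f.

Definition decidable_set (A : set nat) : Prop :=
  computable (fun n => `[< A n >] : nat).

Definition decidable_rel (R : rel nat) : Prop :=
  exists c : recfun 2, forall x y, eval c [tuple x; y] (R x y).

(* [CodeSeq.code : seq nat -> nat] is an effective bijection, with inverse
   [CodeSeq.decode]. *)
Definition decidable_words (A : set (seq nat)) : Prop :=
  decidable_set [set n | A (CodeSeq.decode n)].

(** * Graphs *)

(* Simple undirected graphs; an edge is an unordered pair of distinct
   vertices. *)
Record graph (T : Type) := Graph {
  vertices : set T;
  edges : set (set T);
  edgesP : forall e, edges e ->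
    exists x y, [/\ vertices x, vertices y, x <> y & e = [set x; y]]
}.

Definition adj (T : Type) (G : graph T) : rel T :=
  fun x y => `[< edges G [set x; y] >].

Definition neighbors (T : Type) (G : graph T) (x : T) : set T :=
  [set y | adj G x y].

Definition locally_finite (T : Type) (G : graph T) : Prop :=
  forall x, vertices G x -> finite_set (neighbors G x).

(* The value is meaningful only when [neighbors G x] is finite. *)
Definition degree (T : choiceType) (G : graph T) (x : T) : nat :=
  #|` fset_set (neighbors G x)|%fset.

Definition joined (T : Type) (G : graph T) (x y : T) : Prop :=
  exists p : seq T, path (adj G) x p /\ last x p = y.

Definition connected_graph (T : Type) (G : graph T) : Prop :=
  forall x y, vertices G x -> vertices G y -> joined G x y.

Definition components (T : Type) (G : graph T) : set (set T) :=
  [set [set y | joined G x y] | x in vertices G].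

Definition infinite_components (T : Type) (G : graph T) : set (set T) :=
  [set C | components G C /\ infinite_set C].

Lemma edge_induced_subproof (T : Type) (G : graph T) (F : set (set T)) e :
  (edges G `&` F) e ->
  exists x y, [/\ (\bigcup_(e' in edges G `&` F) e') x,
                  (\bigcup_(e' in edges G `&` F) e') y,
                  x <> y & e = [set x; y]].
Proof.
move=> eF; have [x [y [_ _ xy exy]]] := edgesP eF.1.
by exists x, y; split=> //; exists e => //; rewrite exy; [left|right].
Qed.

(* Its vertices are the endpoints of its edges. *)
Definition edge_induced (T : Type) (G : graph T) (F : set (set T)) : graph T :=
  Graph (@edge_induced_subproof T G F).

Definition remove_edges (T : Type) (G : graph T) (E : set (set T)) : graph T :=
  edge_induced G (edges G `\` E).

Definition ends_bound (T : Type) (G : graph T) (k : nat) : Prop :=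
  forall E : set (set T), E `<=` edges G -> finite_set E ->
    (infinite_components (remove_edges G E) #<= `I_k)%card.

(* [k] is the supremum of the numbers of infinite components of [G] minus a
   finite set of edges. *)
Definition number_of_ends (T : Type) (G : graph T) (k : nat) : Prop :=
  ends_bound G k /\ forall j, ends_bound G j -> k <= j.

Definition finitely_many_ends (T : Type) (G : graph T) : Prop :=
  exists k, number_of_ends G k.

Definition simple_path (T : eqType) (G : graph T) (s : seq T) : Prop :=
  if s is x :: p then [/\ vertices G x, path (adj G) x p & uniq s] else False.

Definition infinite_simple_path (T : Type) (G : graph T) (f : nat -> T) : Prop :=
  (forall n, adj G (f n) (f n.+1)) /\ injective f.

Definition extendable_paths (T : eqType) (G : graph T) : set (seq T) :=
  [set s | simple_path G s /\
     exists f, infinite_simple_path G f /\ mkseq f (size s) = s].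

Definition highly_computable (G : graph nat) : Prop :=
  [/\ decidable_set (vertices G),
      decidable_rel (adj G),
      locally_finite G
    & computable_on (vertices G) (degree G)].

(* Main.v *)
(** Call [w] infinite off [s] if it lies outside the finite set [s] and its
    component in [G] minus [s] is infinite.  A simple path [s] extends to an
    infinite one iff some neighbor [w] of its last vertex is infinite off [s]
    (König), so it suffices to show that this condition and its negation are
    both semi-decidable.  The negation is witnessed by a finite set that contains
    the neighbors of the last vertex off [s] and is closed under adjacency off
    [s].  For the condition itself, fix a finite set [B] whose removal leaves the
    maximal number [m] of infinite components.  Every finite [S] containing [B]
    then also leaves exactly [m] infinite components, so any [m] vertices that
    meet all infinite components of [G] minus [S] lie one in each.  That [m] given
    vertices meet them all is witnessed by a finite [X] containing [S] each of
    whose outer neighbors is joined off [S] to one of them; it remains to join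
    off [s] a neighbor of the last vertex to one of the [m] vertices, for some
    [S] containing [s] and [B].  [B] and [m] are constants of the algorithm, not
    computed from the graph. *)

Require Import Defs.
From mathcomp Require Import all_boot finmap.
From mathcomp Require Import boolp classical_sets cardinality.

Set Implicit Arguments.
Unset Strict Implicit.
Unset Printing Implicit Defensive.

Local Open Scope classical_set_scope.

(** * Total recursive functions *)

(** Variables are de Bruijn indices into an infinite environment: a bound variable is pushed at
    index 0 and the others move up by one, so arities need no casts. *)
Definition env := nat -> nat.

Definition shift (e : env) : env := fun i => e i.+1.

Definition push (x : nat) (e : env) : env :=
  fun i => if i is j.+1 then e j else x.

Definition tup k (e : env) : k.-tuple nat := [tuple of mkseq e k].

Lemma tnth_tup k e (i : 'I_k) : tnth (tup k e) i = e i.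
Proof. by rewrite (tnth_nth 0) /= nth_mkseq. Qed.

Lemma tup_push k x e : tup k.+1 (push x e) = [tuple of x :: tup k e].
Proof.
apply: eq_from_tnth => i; rewrite tnth_tup (tnth_nth 0) /=.
by case: i => [[|i] Hi] //=; rewrite nth_mkseq.
Qed.

(* The variables of an environment beyond the first [k] are irrelevant to a
   [k]-ary recursive function. *)
Definition total_rec k (F : env -> nat) : Prop :=
  exists c : recfun k, forall e, eval c (tup k e) (F e).

Definition dec k (P : env -> Prop) : Prop := total_rec k (fun e => `[< P e >]).

Lemma rec_ext k F F' : (forall e, F e = F' e) -> total_rec k F -> total_rec k F'.
Proof. by move=> E [c Hc]; exists c => e; rewrite -E. Qed.

Lemma rec_var k i : i < k -> total_rec k (fun e => e i).
Proof.
move=> ik; exists (rec_proj (Ordinal ik)) => e.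
have := eval_proj (Ordinal ik) (tup k e); by rewrite tnth_tup.
Qed.

Lemma rec_subst k m (F : env -> nat) (H : nat -> env -> nat) :
  total_rec m F -> (forall i, i < m -> total_rec k (H i)) ->
  total_rec k (fun e => F (fun i => H i e)).
Proof.
move=> [c Hc] HH.
have [h Hh] := choice (fun i : 'I_m => HH i (ltn_ord i)).
exists (rec_comp c h) => e.
apply: (@eval_comp _ _ _ _ _ (tup m (fun i => H i e))) (Hc _) => i.
by rewrite tnth_tup.
Qed.

Lemma rec_0 k : total_rec k (fun=> 0).
Proof. by exists (rec_zero k) => e; apply: eval_zero. Qed.

Lemma rec_S k F : total_rec k F -> total_rec k (fun e => (F e).+1).
Proof.
move=> HF; apply: (@rec_subst k 1 (fun e => (e 0).+1) (fun=> F)) => //.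
exists rec_succ => e; have -> : tup 1 e = [tuple e 0] by apply: val_inj.
exact: eval_succ.
Qed.

Lemma rec_const k n : total_rec k (fun=> n).
Proof. by elim: n => [|n IH]; [apply: rec_0 | apply: rec_S]. Qed.

Lemma rec_iteri k (N A : env -> nat) (H : nat -> nat -> env -> nat) :
  total_rec k N -> total_rec k.+2 (fun e => H (e 0) (e 1) (shift (shift e))) ->
  total_rec k A ->
  total_rec k (fun e => iteri (N e) (fun n z => H n z e) (A e)).
Proof.
move=> HN [h Hh] [a Ha].
(* [rec_prec] recurses on its first argument, so the bound is first made variable 0; [N] is
   substituted for it at the end. *)
pose G e := iteri (e 0) (fun n z => H n z (shift e)) (A (shift e)).
have HG : total_rec k.+1 G.
  exists (rec_prec a h) => e.
  have -> : tup k.+1 e = tup k.+1 (push (e 0) (shift e)).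
    by apply: eq_from_tnth => i; rewrite !tnth_tup; case: i => [[|i] Hi].
  rewrite tup_push /G; move: (e 0) (shift e) => n {}e.
  elim: n => [|n IH] /=; first by apply: eval_prec0; apply: Ha.
  apply: eval_precS IH _.
  have := Hh (push n (push (iteri n (fun n z => H n z e) (A e)) e)).
  rewrite !tup_push /=.
  by congr (eval h); apply: val_inj.
apply: (@rec_subst k k.+1 G
  (fun i => if i is j.+1 then (fun e => e j) else N)) => //.
by case=> [|i] // ik; apply: rec_var.
Qed.

Lemma rec_weaken k F : total_rec k F -> total_rec k.+1 (fun e => F (shift e)).
Proof.
by move=> HF; apply: (rec_subst (H := fun i e => e i.+1)) HF _ => i ik;
  apply: rec_var.
Qed.

Lemma rec_weaken2 k F :
  total_rec k F -> total_rec k.+2 (fun e => F (shift (shift e))).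
Proof. by move=> HF; apply: rec_weaken (rec_weaken HF). Qed.

(** A case distinction is an iteration performed once or not at all, according to the truth value of
    [P]. *)
Lemma rec_if k P F F' : dec k P -> total_rec k F -> total_rec k F' ->
  total_rec k (fun e => if `[< P e >] then F e else F' e).
Proof.
move=> HP HF HF'.
apply: (@rec_ext _ (fun e => iteri `[< P e >] (fun _ _ => F e) (F' e))).
  by move=> e; case: asboolP.
by apply: (rec_iteri (H := fun _ _ => F)) => //; apply: rec_weaken2.
Qed.

Lemma rec_push k F G :
  total_rec k.+1 (fun e => F (e 0) (shift e)) -> total_rec k G ->
  total_rec k (fun e => F (G e) e).
Proof.
move=> HF HG; apply: (@rec_subst k k.+1 (fun e => F (e 0) (shift e))
  (fun i => if i is j.+1 then (fun e => e j) else G)) => //.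
by case=> [|i] // ik; apply: rec_var.
Qed.

Lemma dec_push k (P : nat -> env -> Prop) G :
  dec k.+1 (fun e => P (e 0) (shift e)) -> total_rec k G ->
  dec k (fun e => P (G e) e).
Proof. exact: (rec_push (F := fun n e => `[< P n e >])). Qed.

Lemma rec_search k (P : nat -> env -> Prop) :
  dec k.+1 (fun e => P (e 0) (shift e)) -> (forall e, exists n, P n e) ->
  exists F, total_rec k F /\ forall e, P (F e) e.
Proof.
move=> HP ex; have exb e : exists n, `[< P n e >].
  by have [n] := ex e; exists n; apply/asboolP.
(* [rec_mu] looks for a zero, so truth values are reversed. *)
have [c Hc] : total_rec k.+1 (fun e => if `[< P (e 0) (shift e) >] then 0 else 1).
  by apply: rec_if => //; apply: rec_const.
exists (fun e => ex_minn (exb e)); split=> [|e].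
  exists (rec_mu c) => e; case: ex_minnP => n Pn Hn.
  apply: (@eval_mu _ _ _ _ (fun=> 0)) => [m mn|].
    have := Hc (push m e); rewrite tup_push /=.
    by case: ifP => // /Hn; rewrite leqNgt mn.
  by have := Hc (push n e); rewrite tup_push /= Pn.
by case: ex_minnP => n /asboolP.
Qed.

(** The value is found by searching the decidable graph of [F]; this spares an explicit recursion
    for [F]. *)
Lemma rec_graph k (P : nat -> env -> Prop) F :
  dec k.+1 (fun e => P (e 0) (shift e)) -> (forall e, P (F e) e) ->
  (forall n e, P n e -> n = F e) -> total_rec k F.
Proof.
move=> HP ex uP; have [||F' [HF' PF]] := @rec_search k P => //.
  by move=> e; exists (F e).
by apply: rec_ext HF' => e; apply: uP.
Qed.

Lemma rec_app1 k f F : total_rec 1 (fun e => f (e 0)) -> total_rec k F ->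
  total_rec k (fun e => f (F e)).
Proof. by move=> Hf HF; apply: (rec_subst (H := fun=> F)) Hf _. Qed.

Lemma rec_app2 k f F F' : total_rec 2 (fun e => f (e 0) (e 1)) ->
  total_rec k F -> total_rec k F' -> total_rec k (fun e => f (F e) (F' e)).
Proof.
move=> Hf HF HF'; apply: (rec_subst (H := fun i => nth F [:: F; F'] i)) Hf _.
by case=> [|[|]].
Qed.

Lemma rec_add k F G : total_rec k F -> total_rec k G ->
  total_rec k (fun e => F e + G e).
Proof.
move=> HF HG; apply: (@rec_ext _ (fun e => iteri (F e) (fun _ z => z.+1) (G e))).
  by move=> e; elim: (F e) => //= n ->.
apply: (rec_iteri (H := fun _ z _ => z.+1)) => //.
by apply: rec_S; apply: rec_var.
Qed.

Lemma rec_mul k F G : total_rec k F -> total_rec k G ->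
  total_rec k (fun e => F e * G e).
Proof.
move=> HF HG.
apply: (@rec_ext _ (fun e => iteri (F e) (fun _ z => G e + z) 0)).
  by move=> e; elim: (F e) => //= n ->.
apply: (rec_iteri (H := fun _ z e => G e + z)) (rec_0 _) => //.
by apply: rec_add; [apply: rec_weaken2 | apply: rec_var].
Qed.

Lemma rec_exp k F G : total_rec k F -> total_rec k G ->
  total_rec k (fun e => F e ^ G e).
Proof.
move=> HF HG.
apply: (@rec_ext _ (fun e => iteri (G e) (fun _ z => F e * z) 1)).
  by move=> e; elim: (G e) => //= n ->; rewrite expnS.
apply: (rec_iteri (H := fun _ z e => F e * z)) (rec_const _ 1) => //.
by apply: rec_mul; [apply: rec_weaken2 | apply: rec_var].
Qed.

Lemma rec_pred k F : total_rec k F -> total_rec k (fun e => (F e).-1).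
Proof.
move=> HF; apply: (@rec_ext _ (fun e => iteri (F e) (fun n _ => n) 0)).
  by move=> e; case: (F e).
by apply: (rec_iteri (H := fun n _ _ => n)) (rec_0 _) => //; apply: rec_var.
Qed.

Lemma rec_sub k F G : total_rec k F -> total_rec k G ->
  total_rec k (fun e => F e - G e).
Proof.
move=> HF HG.
apply: (@rec_ext _ (fun e => iteri (G e) (fun _ z => z.-1) (F e))).
  by move=> e; elim: (G e) => [|n /= ->]; rewrite ?subn0 // subnS.
apply: (rec_iteri (H := fun _ z _ => z.-1)) => //.
by apply: rec_pred; apply: rec_var.
Qed.

(** * Decidable predicates: connectives and bounded quantifiers *)

Lemma dec_ext k P Q : (forall e, P e <-> Q e) -> dec k P -> dec k Q.
Proof.
by move=> E; apply: rec_ext => e; congr nat_of_bool; apply: asbool_equiv_eq.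
Qed.

Lemma dec_leq k F G : total_rec k F -> total_rec k G ->
  dec k (fun e => F e <= G e).
Proof.
move=> HF HG.
apply: (@rec_ext _ (fun e => 1 - (F e - G e))).
  by move=> e; rewrite asboolb /leq; case: (F e - G e).
by do 2?[apply: rec_sub => //]; apply: rec_const.
Qed.

Lemma dec_and k P Q : dec k P -> dec k Q -> dec k (fun e => P e /\ Q e).
Proof.
move=> HP HQ.
apply: (@rec_ext _ (fun e => if `[< P e >] then nat_of_bool `[< Q e >] else 0)).
  by move=> e; rewrite asbool_and; case: ifP.
by apply: rec_if => //; apply: rec_const.
Qed.

Lemma dec_not k P : dec k P -> dec k (fun e => ~ P e).
Proof.
move=> HP; apply: (@rec_ext _ (fun e => if `[< P e >] then 0 else 1)).
  by move=> e; rewrite asbool_neg; case: ifP.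
by apply: rec_if => //; apply: rec_const.
Qed.

Lemma dec_or k P Q : dec k P -> dec k Q -> dec k (fun e => P e \/ Q e).
Proof.
move=> HP HQ; apply: (@dec_ext _ (fun e => ~ (~ P e /\ ~ Q e))).
  by move=> e; rewrite not_andP !notK.
by apply/dec_not/dec_and; apply: dec_not.
Qed.

Lemma dec_eq k F G : total_rec k F -> total_rec k G ->
  dec k (fun e => F e = G e).
Proof.
move=> HF HG; apply: (@dec_ext _ (fun e => F e <= G e /\ G e <= F e)).
  move=> e; split=> [[h1 h2]|->//]; by apply/eqP; rewrite eqn_leq h1 h2.
by apply: dec_and; apply: dec_leq.
Qed.

Lemma dec_all k N (P : nat -> env -> Prop) :
  total_rec k N -> dec k.+1 (fun e => P (e 0) (shift e)) ->
  dec k (fun e => forall i, i < N e -> P i e).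
Proof.
move=> HN HP.
apply: (@rec_ext _ (fun e => iteri (N e) (fun n z =>
    if `[< P n e >] then z else 0) 1)).
  move=> e; elim: (N e) => [|n /= ->]; first by rewrite (asboolT _).
  case: asboolP => [Pn|nPn]; last first.
    by rewrite asboolF // => /(_ n (ltnSn n)).
  congr nat_of_bool; apply: asbool_equiv_eq; split=> h i.
    by rewrite ltnS leq_eqVlt => /predU1P[->//|/h].
  by move=> ?; apply/h/ltnW.
apply: (rec_iteri (H := fun n z e => if `[< P n e >] then z else 0)) => //.
  apply: (@rec_if _ (fun e => P (e 0) (shift (shift e)))).
  (* Variable 1 is the accumulator of the iteration, which [P] must skip. *)
  - apply: (@rec_subst _ k.+1 (fun e => `[< P (e 0) (shift e) >])
      (fun i => if i is j.+1 then (fun e => e j.+2) else (fun e => e 0))) => //.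
    by case=> [|i] ?; apply: rec_var.
  - exact: rec_var.
  - exact: rec_0.
exact: rec_const.
Qed.

Lemma dec_ex k N (P : nat -> env -> Prop) :
  total_rec k N -> dec k.+1 (fun e => P (e 0) (shift e)) ->
  dec k (fun e => exists i, i < N e /\ P i e).
Proof.
move=> HN HP.
apply: (@dec_ext _ (fun e => ~ (forall i, i < N e -> ~ P i e))).
  move=> e; split=> [/existsNP[i /not_implyP[? /contrapT]]|[i [iN Pi]] /(_ i iN)//].
  by exists i.
by apply/dec_not/(dec_all (P := fun i e => ~ P i e)) => //; apply: dec_not.
Qed.

Lemma dec_app1 k (P : nat -> Prop) F : dec 1 (fun e => P (e 0)) ->
  total_rec k F -> dec k (fun e => P (F e)).
Proof. exact: (rec_app1 (f := fun x => `[< P x >])). Qed.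

Lemma dec_app2 k (P : nat -> nat -> Prop) F F' :
  dec 2 (fun e => P (e 0) (e 1)) -> total_rec k F -> total_rec k F' ->
  dec k (fun e => P (F e) (F' e)).
Proof. exact: (rec_app2 (f := fun x y => `[< P x y >])). Qed.

(** Extension point of [rec_tac], redefined once sequences and graphs have their closure lemmas. *)
Ltac rec_hook := fail.

Ltac rec_tac :=
  cbv beta delta [shift];
  match goal with
  | |- total_rec _ _ => first
    [ exact: rec_const | (apply: rec_var; reflexivity)
    | apply: rec_S; rec_tac | apply: rec_add; rec_tac | apply: rec_mul; rec_tac
    | apply: rec_exp; rec_tac | apply: rec_pred; rec_tac | rec_hook; rec_tac ]
  | |- dec _ _ => first
    [ apply: dec_leq; rec_tac | apply: dec_eq; rec_tac
    | apply: dec_and; rec_tac | apply: dec_or; rec_tac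
    | apply: dec_not; rec_tac | apply: dec_all; rec_tac
    | apply: dec_ex; rec_tac | rec_hook; rec_tac ]
  end.

(** * Semi-decidable predicates *)

Definition sigma1 k (P : env -> Prop) : Prop :=
  exists Q : nat -> env -> Prop,
    dec k.+1 (fun e => Q (e 0) (shift e)) /\ forall e, P e <-> exists n, Q n e.

Lemma sigma1_ext k P Q : (forall e, P e <-> Q e) -> sigma1 k P -> sigma1 k Q.
Proof. by move=> E [W [HW PW]]; exists W; split=> // e; rewrite -E PW. Qed.

Lemma dec_weaken k P : dec k P -> dec k.+1 (fun e => P (shift e)).
Proof. exact: rec_weaken. Qed.

Lemma dec_sigma1 k P : dec k P -> sigma1 k P.
Proof.
move=> HP; exists (fun _ => P); split; first exact: dec_weaken.
by move=> e; split=> [|[]//]; exists 0.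
Qed.

(* Conjunctions and quantifiers are absorbed into the witness by bounding all
   the searches by a common number. *)
Lemma sigma1_mono k P : sigma1 k P ->
  exists Q : nat -> env -> Prop, [/\ dec k.+1 (fun e => Q (e 0) (shift e)),
    forall e, P e <-> exists n, Q n e &
    forall e m n, m <= n -> Q m e -> Q n e].
Proof.
move=> [Q [HQ PQ]]; exists (fun n e => exists i, i < n.+1 /\ Q i e); split.
- apply: (@dec_ex k.+1 _ (fun i e => Q i (shift e))).
    by apply: rec_S; apply: rec_var.
  apply: (@rec_subst _ k.+1 (fun e => `[< Q (e 0) (shift e) >])
    (fun i => if i is j.+1 then (fun e => e j.+2) else (fun e => e 0))) => //.
  by case=> [|i] ?; apply: rec_var.
- move=> e; rewrite PQ; split=> [[n Qn]|[n [i [_ Qi]]]]; last by exists i.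
  by exists n, n.
- by move=> e m n mn [i [im Qi]]; exists i; split=> //; apply: leq_trans im _.
Qed.

Lemma sigma1_and k P P' : sigma1 k P -> sigma1 k P' ->
  sigma1 k (fun e => P e /\ P' e).
Proof.
move=> /sigma1_mono[Q [HQ PQ mQ]] /sigma1_mono[Q' [HQ' PQ' mQ']].
exists (fun n e => Q n e /\ Q' n e); split; first exact: dec_and.
move=> e; rewrite PQ PQ'; split=> [[[n Qn] [m Qm]]|[n [? ?]]].
  exists (maxn n m); split; [apply: mQ Qn|apply: mQ' Qm].
    exact: leq_maxl.
  exact: leq_maxr.
by split; exists n.
Qed.

Lemma sigma1_or k P P' : sigma1 k P -> sigma1 k P' ->
  sigma1 k (fun e => P e \/ P' e).
Proof.
move=> [Q [HQ PQ]] [Q' [HQ' PQ']].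
exists (fun n e => Q n e \/ Q' n e); split; first exact: dec_or.
move=> e; rewrite PQ PQ'; split=> [[[n ?]|[n ?]]|[n [?|?]]].
- by exists n; left.
- by exists n; right.
- by left; exists n.
- by right; exists n.
Qed.

Lemma sigma1_ex k (P : nat -> env -> Prop) :
  sigma1 k.+1 (fun e => P (e 0) (shift e)) -> sigma1 k (fun e => exists x, P x e).
Proof.
move=> /sigma1_mono[Q [HQ PQ mQ]].
exists (fun n e => exists x, x < n.+1 /\ Q n (push x e)); split.
  apply: (@dec_ex k.+1 _ (fun x e => Q (e 0) (push x (shift e)))).
    by apply: rec_S; apply: rec_var.
  (* The quantified [x] is variable 0 and the common bound is variable 1, while [Q] takes the bound
     first; the substitution below exchanges them. *)
  apply: (@dec_ext _ (fun e => Q (e 1) (fun i => if i is j.+1 then e j.+2 else e 0))).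
    by [].
  apply: (@rec_subst k.+2 k.+2 (fun e => `[< Q (e 0) (shift e) >])
    (fun i e => if i is j.+1 then (if j is l.+1 then e l.+2 else e 0) else e 1)) => //.
  by case=> [|[|i]] ?; apply: rec_var.
move=> e; split=> [[x Px]|[n [x [_ Qx]]]].
  have [n Qn] := (PQ (push x e)).1 Px.
  exists (maxn n x), x; split; first by rewrite ltnS leq_maxr.
  by apply: mQ Qn; apply: leq_maxl.
by exists x; apply: ((PQ (push x e)).2); exists n.
Qed.

Lemma sigma1_all k N (P : nat -> env -> Prop) :
  total_rec k N -> sigma1 k.+1 (fun e => P (e 0) (shift e)) ->
  sigma1 k (fun e => forall i, i < N e -> P i e).
Proof.
move=> HN /sigma1_mono[Q [HQ PQ mQ]].
exists (fun n e => forall i, i < N e -> Q n (push i e)); split.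
  apply: (@dec_all k.+1 _ (fun x e => Q (e 0) (push x (shift e)))).
    exact: rec_weaken.
  apply: (@dec_ext _ (fun e => Q (e 1) (fun i => if i is j.+1 then e j.+2 else e 0))).
    by [].
  apply: (@rec_subst k.+2 k.+2 (fun e => `[< Q (e 0) (shift e) >])
    (fun i e => if i is j.+1 then (if j is l.+1 then e l.+2 else e 0) else e 1)) => //.
  by case=> [|[|i]] ?; apply: rec_var.
move=> e; split=> [|[n Qn] i iN]; last first.
  by apply: ((PQ (push i e)).2); exists n; apply: Qn.
(* By monotonicity of [Q], the maximum of the finitely many witnesses serves all [i] at once. *)
elim: (N e) => [|m IH] h; first by exists 0.
have [n Qn] : exists n, forall i, i < m -> Q n (push i e).
  by apply: IH => i im; apply/h/ltnW.
have [n' Qn'] := (PQ (push m e)).1 (h m (ltnSn m)).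
exists (maxn n n') => i; rewrite ltnS leq_eqVlt => /predU1P[->|im].
  by apply: mQ Qn'; apply: leq_maxr.
by apply: mQ (Qn _ im); apply: leq_maxl.
Qed.

Lemma sigma1_subst k m P (H : nat -> env -> nat) :
  sigma1 m P -> (forall i, i < m -> total_rec k (H i)) ->
  sigma1 k (fun e => P (fun i => H i e)).
Proof.
move=> [Q [HQ PQ]] HH; exists (fun n e => Q n (fun i => H i e)); split=> //.
apply: (@rec_subst k.+1 m.+1 (fun e => `[< Q (e 0) (shift e) >])
  (fun i e => if i is j.+1 then H j (shift e) else e 0)) => //.
case=> [|i] im; first exact: rec_var.
by apply: rec_weaken; apply: HH.
Qed.

Lemma sigma1_app3 k (P : nat -> nat -> nat -> Prop) F F' F'' :
  sigma1 3 (fun e => P (e 0) (e 1) (e 2)) ->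
  total_rec k F -> total_rec k F' -> total_rec k F'' ->
  sigma1 k (fun e => P (F e) (F' e) (F'' e)).
Proof.
move=> HP HF HF' HF''.
apply: (sigma1_subst (H := fun i => nth F [:: F; F'; F''] i)) HP _.
by case=> [|[|[|]]].
Qed.

(** Post's theorem: a joint search for a witness of either side always ends, and testing [Q] at the
    number found decides [P]. *)
Lemma post_dec k P : sigma1 k P -> sigma1 k (fun e => ~ P e) -> dec k P.
Proof.
move=> [Q [HQ PQ]] [Q' [HQ' PQ']].
have [||F [HF QF]] := @rec_search k (fun n e => Q n e \/ Q' n e).
- exact: dec_or.
- move=> e; have [Pe|nPe] := pselect (P e).
    by have [n] := (PQ e).1 Pe; exists n; left.
  by have [n] := (PQ' e).1 nPe; exists n; right.
apply: dec_ext (dec_push HQ HF) => e; split=> [QFe|Pe].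
  by apply: ((PQ e).2); exists (F e).
by case: (QF e) => // Q'Fe; case: ((PQ' e).2) => //; exists (F e).
Qed.

(** * Codes of sequences *)

Notation decode := CodeSeq.decode.
Notation code := CodeSeq.code.

Lemma decode_cons x m : decode (2 ^ x * m.*2.+1) = x :: decode m.
Proof. by rewrite -[RHS]CodeSeq.codeK /= CodeSeq.decodeK. Qed.

(** Both the head and the code of the tail lie below the code of the sequence, so a bounded search
    suffices to take a code apart. *)
Lemma decode_cases n :
  n = 0 \/ exists x m, [/\ x < n, m < n & n = 2 ^ x * (2 * m).+1].
Proof.
have E := CodeSeq.decodeK n; case: (decode n) E => [|x s] /= <-; first by left.
right; exists x, (code s); split; last by rewrite mul2n.
  by apply: leq_trans (ltn_expl x (ltnSn 1)) _; rewrite leq_pmulr.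
apply: (@leq_trans (code s).*2.+1); last by rewrite leq_pmull // expn_gt0.
by rewrite ltnS -addnn leq_addr.
Qed.

(** Both functions take the value 0 at 0, the code of the empty sequence. *)
Definition code_head n := head 0 (decode n).
Definition code_behead n := code (behead (decode n)).

Lemma rec_code_head : total_rec 1 (fun e => code_head (e 0)).
Proof.
apply: (@rec_graph 1 (fun x e => (e 0 = 0 /\ x = 0) \/
    exists m, m < e 0 /\ e 0 = 2 ^ x * (2 * m).+1)).
- rec_tac.
- move=> e; case: (decode_cases (e 0)) => [->|[x [m [_ mn E]]]]; first by left.
  by right; exists m; split=> //; rewrite {2}E /code_head mul2n decode_cons -mul2n.
- by move=> n e [[-> ->]//|[m [_ ->]]]; rewrite /code_head mul2n decode_cons.
Qed.

Lemma rec_code_behead : total_rec 1 (fun e => code_behead (e 0)).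
Proof.
apply: (@rec_graph 1 (fun m e => (e 0 = 0 /\ m = 0) \/
    exists x, x < e 0 /\ e 0 = 2 ^ x * (2 * m).+1)).
- rec_tac.
- move=> e; case: (decode_cases (e 0)) => [->|[x [m [xn _ E]]]]; first by left.
  right; exists x; split=> //.
  by rewrite {1}E /code_behead E !mul2n decode_cons /= CodeSeq.decodeK.
- move=> n e [[-> ->]//|[m [_ ->]]].
  by rewrite /code_behead mul2n decode_cons /= CodeSeq.decodeK.
Qed.

Lemma rec_drop : total_rec 2 (fun e => code (drop (e 0) (decode (e 1)))).
Proof.
apply: (@rec_ext _ (fun e => iteri (e 0) (fun _ z => code_behead z) (e 1))).
  move=> e; elim: (e 0) => [|n /= ->]; first by rewrite drop0 CodeSeq.decodeK.
  by rewrite /code_behead CodeSeq.codeK -drop1 drop_drop add1n.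
apply: (rec_iteri (H := fun _ z _ => code_behead z)); try by rec_tac.
by apply: (rec_app1 (f := code_behead)) rec_code_behead _; rec_tac.
Qed.

Lemma rec_nth2 : total_rec 2 (fun e => nth 0 (decode (e 0)) (e 1)).
Proof.
apply: (@rec_ext _ (fun e => code_head (code (drop (e 1) (decode (e 0)))))).
  by move=> e; rewrite /code_head CodeSeq.codeK -nth0 nth_drop addn0.
apply: rec_app1; first exact: rec_code_head.
by apply: (rec_app2 (f := fun i n => code (drop i (decode n)))
      rec_drop); rec_tac.
Qed.

(** The size is the least number of entries whose removal leaves the empty sequence, coded by 0. *)
Lemma rec_size1 : total_rec 1 (fun e => size (decode (e 0))).
Proof.
apply: (@rec_graph 1 (fun x e => code (drop x (decode (e 0))) = 0 /\
  forall i, i < x -> 0 < code (drop i (decode (e 0))))).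
- apply: dec_and.
    by apply: dec_eq; [apply: (rec_app2 (f := fun i n => code (drop i (decode n)))
      rec_drop)|]; rec_tac.
  apply: (@dec_all _ _ (fun i e => 0 < code (drop i (decode (e 1))))).
    rec_tac.
  by apply: dec_leq; [|apply: (rec_app2 (f := fun i n => code (drop i (decode n)))
      rec_drop)]; rec_tac.
- move=> e; split=> [|i]; first by rewrite drop_size.
  by move/(drop_nth 0)->; rewrite /= muln_gt0 expn_gt0.
- move=> n e [/(congr1 decode) + H]; rewrite CodeSeq.codeK => E.
  have := congr1 size E; rewrite size_drop => /eqP; rewrite subn_eq0 => le_s.
  apply/eqP; rewrite eqn_leq le_s andbT leqNgt; apply/negP => /H.
  by rewrite drop_size.
Qed.

Lemma rec_nth k N I : total_rec k N -> total_rec k I ->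
  total_rec k (fun e => nth 0 (decode (N e)) (I e)).
Proof. exact: (rec_app2 (f := fun n i => nth 0 (decode n) i)) rec_nth2. Qed.

Lemma rec_size k N : total_rec k N -> total_rec k (fun e => size (decode (N e))).
Proof. exact: (rec_app1 (f := fun n => size (decode n))) rec_size1. Qed.

Lemma dec_mem k X N : total_rec k X -> total_rec k N ->
  dec k (fun e => X e \in decode (N e)).
Proof.
apply: (dec_app2 (P := fun x n => x \in decode n)).
apply: (@dec_ext _ (fun e => exists i, i < size (decode (e 1)) /\
    nth 0 (decode (e 1)) i = e 0)).
  move=> e; split=> [[i [il <-]]|/(nthP 0)[i il ie]]; first exact: mem_nth.
  by exists i.
apply: (@dec_ex _ _ (fun i e => nth 0 (decode (e 1)) i = e 0)).
  by apply: rec_size; rec_tac.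
by apply: dec_eq; [apply: rec_nth|]; rec_tac.
Qed.

(** * Components of the complement of a finite set *)

Section Avoiding.
Variables (T : choiceType) (G : graph T).
Implicit Types (S X U : seq T) (x y z w : T).

Lemma adjC x y : adj G x y = adj G y x.
Proof. by rewrite /adj setUC. Qed.

Lemma adj_vertices x y : adj G x y -> vertices G x /\ vertices G y.
Proof.
move/asboolP/edgesP => [a [b [Va Vb _ E]]].
have H z : [set x; y] z -> vertices G z by rewrite E => -[->|->].
by split; apply: H; [left|right].
Qed.

(** Vertices are deleted here, since a simple path must avoid its own past, whereas ends are defined
    by deleting edges; [indep_size] links the two. *)
Definition conn S x y : Prop :=
  exists p : seq T, [/\ path (adj G) x p, all (fun z => z \notin S) (x :: p)
                      & last x p = y].

Definition infc S x : Prop := x \notin S /\ infinite_set (conn S x).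

Lemma conn_refl S x : x \notin S -> conn S x x.
Proof. by move=> xS; exists [::]; rewrite /= xS. Qed.

Lemma conn_notin S x y : conn S x y -> y \notin S.
Proof. by move=> [p [_ /allP h <-]]; apply/h/mem_last. Qed.

Lemma conn_step S x y z : conn S x y -> adj G y z -> z \notin S -> conn S x z.
Proof.
move=> [p [xp aS <-]] yz zS; exists (rcons p z).
by rewrite rcons_path xp last_rcons -rcons_cons all_rcons zS aS.
Qed.

Lemma conn_ind S x y (P : T -> Prop) : conn S x y -> P x ->
  (forall a b, P a -> adj G a b -> b \notin S -> P b) -> P y.
Proof.
move=> [p [+ + <-]] + HP; elim: p x => [|a p IH] x //=.
move=> /andP[xa ap] /and3P[xS aS pS] Px.
by apply: IH => //=; rewrite ?aS //; apply: HP xa aS.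
Qed.

Lemma conn_trans S x y z : conn S x y -> conn S y z -> conn S x z.
Proof. by move=> xy /conn_ind; apply=> // a b; apply: conn_step. Qed.

Lemma conn_sym S x y : conn S x y -> conn S y x.
Proof.
move=> xy; have xS : x \notin S by case: xy => p [_ /andP[]].
suff [] : conn S y x /\ y \notin S by [].
apply: (conn_ind (P := fun z => conn S z x /\ z \notin S) xy)
  => [|a b [ax aS] ab bS]; first by split=> //; apply: conn_refl.
split=> //; apply: conn_trans ax.
by apply: conn_step (conn_refl bS) _ aS; rewrite adjC.
Qed.

Lemma conn_sub S S' x y : {subset S <= S'} -> conn S' x y -> conn S x y.
Proof.
move=> sS [p [xp /allP h <-]]; exists p; split=> //.
by apply/allP => z /h; apply/contra/sS.
Qed.

Lemma infc_conn S x y : conn S x y -> infc S x -> infc S y.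
Proof.
move=> xy [_ xinf]; split; first exact: conn_notin xy.
apply: sub_infinite_set xinf => z; exact: conn_trans (conn_sym xy).
Qed.

Lemma infc_sub S S' x : {subset S <= S'} -> infc S' x -> infc S x.
Proof.
move=> sS [xS xinf]; split; first by apply: contra xS; apply: sS.
by apply: sub_infinite_set xinf => z; apply: conn_sub.
Qed.

(** Follow the path up to its first vertex [z] in [S']; [w] is the vertex just before. *)
Lemma conn_hit S S' x y : conn S x y -> x \notin S' ->
  conn S' x y \/
  exists w z, [/\ conn S' x w, adj G w z, z \in S' & z \notin S].
Proof.
move=> xy xS'; apply: (conn_ind (P := fun y => conn S' x y \/
  exists w z, [/\ conn S' x w, adj G w z, z \in S' & z \notin S]) xy)
  => [|a b [xa|?] ab bS].
- by left; apply: conn_refl.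
- have [bS'|bS'] := boolP (b \in S'); last by left; apply: conn_step ab bS'.
  by right; exists a, b.
- by right.
Qed.

Hypothesis Glf : locally_finite G.

Lemma finite_neighbors x : finite_set (neighbors G x).
Proof.
have [/Glf//|nVx] := pselect (vertices G x).
rewrite (_ : neighbors G x = set0) //; apply/seteqP; split=> // y /adj_vertices.
by case.
Qed.

Lemma finite_boundary S : finite_set [set w | exists2 z, z \in S & adj G w z].
Proof.
rewrite (_ : [set w | _] = \bigcup_(z in [set` S]) neighbors G z).
  by apply: bigcup_finite => // z _; apply: finite_neighbors.
apply/seteqP; split=> w /= [z zS]; exists z => //; rewrite /neighbors /= adjC //.
Qed.

(** Otherwise the component of [x] off [S] is covered by [S'] and by finite components off [S'].
    Only finitely many of these occur, since each contains [x] or a neighbor of [S']. *)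
Lemma infc_escape S S' x : infc S x ->
  exists y, conn S x y /\ infc S' y.
Proof.
move=> [xS xinf]; apply: contrapT => /forallNP no.
pose D z := [set y | conn S x y /\ conn S' y z].
have finD z : finite_set (D z).
  have [->|/set0P[y [xy yz]]] := eqVneq (D z) set0; first exact: finite_set0.
  have fy : finite_set (conn S' y).
    apply: contrapT => inf; apply: (no y); split=> //; split=> //.
    exact: conn_notin (conn_sym yz).
  apply: sub_finite_set fy => y' [_ y'z].
  exact: conn_trans yz (conn_sym y'z).
pose N := [set w | exists2 z, z \in S' & adj G w z].
apply: xinf.
apply: (@sub_finite_set _ _ ([set` S'] `|` (D x `|` \bigcup_(z in N) D z))).
  move=> y /= xy; have [?|yS'] := boolP (y \in S'); [by left|right].
  (* Walking back from [y] to [x], either [x] is reached off [S'] or some neighbor [w] of [S']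
     is. *)
  case: (conn_hit (conn_sym xy) yS') => [yx|[w [z [yw wz zS' _]]]]; first by left.
  by right; exists w => //; exists z.
rewrite !finite_setU; do 2?split=> //.
by apply: bigcup_finite => //; apply: finite_boundary.
Qed.

(** The inductive step of König's lemma. From a vertex [y] infinite off [x :: S], walk back to [x]
    off [S]: the first vertex of [x :: S] on the way can only be [x], and [w] precedes it. *)
Lemma infc_neighbor S x : infc S x -> exists w, adj G x w /\ infc (x :: S) w.
Proof.
move=> xinf; have [y [xy yinf]] := infc_escape (x :: S) xinf.
case: (conn_hit (conn_sym xy) yinf.1) => [/conn_notin|[w [z [yw wz]]]].
  by rewrite inE eqxx.
rewrite inE => /orP[/eqP zx _|->//]; exists w; rewrite adjC -zx; split=> //.
by rewrite zx; apply: infc_conn yw yinf.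
Qed.

Lemma infc_vertex S x : infc S x -> vertices G x.
Proof. by move=> /infc_neighbor[w [/adj_vertices[]]]. Qed.

(** * Counting infinite components by representatives *)

Definition indep S U : Prop :=
  [/\ uniq U, forall u, u \in U -> infc S u
    & forall u v, u \in U -> v \in U -> conn S u v -> u = v].

Lemma indep_size k S U : ends_bound G k -> indep S U -> size U <= k.
Proof.
move=> Gk [uU Uinf Uconn].
(* Without the edges that meet [S], the component of a vertex off [S] is its component in the sense
   of [conn S]. *)
pose E := edges G `&` [set e | exists2 z, z \in S & e z].
have finE : finite_set E.
  apply: (@sub_finite_set _ _ (\bigcup_(z in [set` S])
      [set [set z; y] | y in neighbors G z])).
    move=> e [Ge [z zS ez]]; exists z => //=.
    have [a [b [_ _ _ eab]]] := edgesP Ge.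
    have Gab : adj G a b by apply/asboolP; rewrite -eab.
    move: ez; rewrite eab => -[->|->]; first by exists b.
    by exists a; [rewrite /neighbors /= adjC | rewrite setUC].
  apply: bigcup_finite => // z _; apply: finite_image; exact: finite_neighbors.
pose G' := remove_edges G E.
have adjE x y : adj G' x y <-> [/\ adj G x y, x \notin S & y \notin S].
  split.
    move/asboolP => [Gxy [_ nE]]; split; first exact/asboolP.
      by apply/negP => xS; apply: nE; split=> //; exists x => //; left.
    by apply/negP => xS; apply: nE; split=> //; exists y => //; right.
  move=> [/asboolP xy xS yS]; apply/asboolP; split=> //; split=> // -[_ [z zS]].
  by move=> [] zE; move: zS; rewrite zE ?(negPf xS) ?(negPf yS).
have compE x : x \notin S -> [set y | joined G' x y] = conn S x.
  move=> xS; apply/seteqP; split=> y.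
    move=> [p [xp <-]]; elim/last_ind: p xp => [|p z IH].
      by move=> _; apply: conn_refl.
    rewrite rcons_path last_rcons => /andP[/IH xl /adjE[lz _ zS]].
    exact: conn_step lz zS.
  move=> xy; suff [] : [set y | joined G' x y] y /\ y \notin S by [].
  apply: (conn_ind (P := fun y => [set y | joined G' x y] y /\ y \notin S) xy)
    => [|a b [[p [xp pa]] aS] ab bS].
    by split=> //; exists [::].
  split=> //; exists (rcons p b); rewrite last_rcons rcons_path xp pa /=; split=> //.
  exact/adjE.
have H := Gk E (@subIsetl _ _ _) finE.
have [->//|[u0 u0U]] : U = [::] \/ exists u, u \in U.
  by case: (U) => [|u s]; [left|right; exists u; rewrite mem_head].
pose f i := conn S (nth u0 U i).
have finj : {in `I_(size U) &, injective f}.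
  move=> i j; rewrite !inE /= => iU jU fij.
  have : f j (nth u0 U j) by apply/conn_refl; case: (Uinf _ (mem_nth u0 jU)).
  rewrite -fij => /Uconn-/(_ (mem_nth u0 iU) (mem_nth u0 jU))/eqP.
  by rewrite nth_uniq // => /eqP.
rewrite -card_le_II -(card_le_eql (inj_card_eq finj)).
apply: card_le_trans H; apply: subset_card_le => _ [i iU <-].
have uinf := Uinf _ (mem_nth u0 iU); split; last by case: uinf.
(* The vertices of [G'] are the endpoints of remaining edges, so each representative needs an edge
   that avoids [S]. *)
have [w [uw winf]] := infc_neighbor uinf.
exists (nth u0 U i); last by apply: compE; case: uinf.
have /adjE/asboolP[Gu nE] : [/\ adj G (nth u0 U i) w, nth u0 U i \notin S & w \notin S].
  split=> //; first by case: uinf.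
  by case: winf; rewrite inE negb_or => /andP[].
by exists [set nth u0 U i; w]; [split | left].
Qed.

(** The sizes of independent families, over all [S] together, are bounded by [k], so a largest one
    is attained. *)
Lemma max_indep k : ends_bound G k ->
  exists B U0, indep B U0 /\ forall S U, indep S U -> size U <= size U0.
Proof.
move=> Gk; pose P n := `[< exists S U, indep S U /\ size U = n >].
have exP : exists n, P n by exists 0; apply/asboolP; exists [::], [::].
have leP n : P n -> n <= k.
  by move/asboolP => [S [U [SU <-]]]; apply: indep_size Gk SU.
case: (ex_maxnP exP leP) => n /asboolP[B [U0 [BU0 <-]]] Hmax.
by exists B, U0; split=> // S U SU; apply/Hmax/asboolP; exists S, U.
Qed.

(** * Finite certificates *)

Definition covers S U : Prop :=
  forall x, infc S x -> exists u, u \in U /\ conn S x u.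

(** A certificate for [covers] that quantifies universally only over [X] and its neighbors, hence is
    semi-decidable. *)
Definition frontier S U X : Prop :=
  forall x, x \in X -> forall y, adj G x y ->
    y \in X \/ exists u, u \in U /\ conn S y u.

(** An infinite component off [S] has a vertex [y] outside the finite [X]. A walk in [G] from [y] to
    [v] must enter [X]; just before, it is at an outer neighbor of [X], which is joined to [U] off
    [S]. *)
Lemma frontier_covers S U X v : connected_graph G -> vertices G v -> v \in S ->
  {subset S <= X} -> frontier S U X -> covers S U.
Proof.
move=> Gconn Vv vS SX XU x xinf.
have [y xy yX] : exists2 y, conn S x y & y \notin X.
  apply: contrapT => no; apply: xinf.2.
  apply: (@sub_finite_set _ _ [set` X]) => // y xy /=.
  by apply/negPn/negP => yX; apply: no; exists y.
have yv : conn [::] y v.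
  have [p [yp pv]] := Gconn y v (infc_vertex (infc_conn xy xinf)) Vv.
  by exists p; split=> //; apply/allP.
case: (conn_hit yv yX) => [/conn_notin|[w [z [yw wz zX _]]]].
  by rewrite SX.
have [wX|[u [uU wu]]] := XU z zX w (etrans (adjC _ _) wz).
  by have := conn_notin yw; rewrite wX.
exists u; split=> //; apply: conn_trans wu.
by apply: conn_trans xy _; apply: conn_sub yw.
Qed.

(** Take for [X] the set [S] together with the finite components off [S] that touch it. An outer
    neighbor of [X] is then a neighbor of [S] whose component off [S] is infinite. *)
Lemma covers_frontier S U : covers S U ->
  exists X, {subset S <= X} /\ frontier S U X.
Proof.
move=> SU; pose N := [set w | exists2 z, z \in S & adj G w z].
pose A := [set` S] `|` \bigcup_(w in N `&` [set w | ~ infinite_set (conn S w)])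
  conn S w.
have /finite_seqP[X AX] : finite_set A.
  rewrite finite_setU; split=> //; apply: bigcup_finite.
    by apply: finite_setIl; apply: finite_boundary.
  by move=> w [_ /contrapT].
have XA y : (y \in X) <-> A y by rewrite AX.
exists X; split=> [z zS|x /XA xA y xy]; first by apply/XA; left.
have [|yX] := boolP (y \in X); [by left | right].
have yS : y \notin S by apply: contra yX => yS; apply/XA; left.
case: xA => [/= xS|[w [Nw finw] wx]]; last first.
  by move/negP: yX => []; apply/XA; right; exists w => //; apply: conn_step xy yS.
apply: SU; split=> //; apply: contrapT => yfin; move/negP: yX; apply; apply/XA.
right; exists y; last exact: conn_refl.
by split=> //; exists x => //; rewrite adjC.
Qed.

(** The smallest [X] is the union of the components off [s] of the neighbors of [z]; it is finite
    exactly when none of them is infinite. *)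
Lemma not_ext s z :
  ~ (exists w, adj G z w /\ infc s w) <->
  exists X, (forall w, adj G z w -> w \in s \/ w \in X) /\
    forall x, x \in X -> forall y, adj G x y -> y \in s \/ y \in X.
Proof.
split=> [no|[X [zX XX]] [w [zw [ws winf]]]]; last first.
  apply: winf; apply: (@sub_finite_set _ _ [set` X]) => // y wy /=.
  apply: (conn_ind (P := fun y => y \in X) wy).
    by case: (zX _ zw) => //; rewrite (negPf ws).
  by move=> a b aX ab bs; case: (XX _ aX _ ab) => //; rewrite (negPf bs).
pose A := \bigcup_(w in neighbors G z `&` [set w | w \notin s]) conn s w.
have /finite_seqP[X AX] : finite_set A.
  apply: bigcup_finite; first by apply: finite_setIl; apply: finite_neighbors.
  by move=> w [zw ws]; apply: contrapT => winf; apply: no; exists w.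
have XA y : (y \in X) <-> A y by rewrite AX.
exists X; split=> [w zw|x /XA[w [zw ws] wx] y xy].
  have [|ws] := boolP (w \in s); [by left | right].
  by apply/XA; exists w => //; apply: conn_refl.
have [|ys] := boolP (y \in s); [by left | right].
by apply/XA; exists w => //; apply: conn_step xy ys.
Qed.

(** * Separators that leave the maximal number of infinite components *)

Section MaximalSeparator.
Variables (B U0 : seq T).
Hypotheses (BU0 : indep B U0)
  (U0max : forall S U, indep S U -> size U <= size U0).

(** Each representative in [U0] is moved within its component off [B] to a vertex infinite off [S].
    The results stay in distinct components, and one more component would contradict maximality. *)
Lemma indep_covers S : {subset B <= S} ->
  exists U, [/\ size U = size U0, indep S U & covers S U].
Proof.
case: BU0 => uU Uinf Uconn BS.
have /choice[g Hg] u : exists v, u \in U0 -> conn B u v /\ infc S v.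
  have [/Uinf/(infc_escape S)[v]|] := boolP (u \in U0); first by exists v.
  by exists u.
have SU : indep S (map g U0).
  split.
  - rewrite map_inj_in_uniq // => u v uU0 vU0 guv; apply: Uconn => //.
    apply: conn_trans (Hg _ uU0).1 _; rewrite guv.
    exact: conn_sym (Hg _ vU0).1.
  - by move=> _ /mapP[u uU0 ->]; case: (Hg _ uU0).
  - move=> _ _ /mapP[u uU0 ->] /mapP[v vU0 ->] guv; congr g; apply: Uconn => //.
    apply: conn_trans (Hg _ uU0).1 (conn_trans _ (conn_sym (Hg _ vU0).1)).
    exact: conn_sub guv.
exists (map g U0); split=> //; first by rewrite size_map.
move=> x xinf; apply: contrapT => /forallNP no.
suff /U0max : indep S (x :: map g U0) by rewrite /= size_map ltnn.
case: SU => uU' U'inf U'conn; split=> /=.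
- rewrite uU' andbT; apply/negP => xU; apply: (no x); split=> //.
  by apply: conn_refl; case: xinf.
- by move=> u; rewrite inE => /predU1P[->|/U'inf].
- move=> u v; rewrite !inE => /predU1P[->|uU1] /predU1P[->|vU1] // uv.
  + by case: (no v).
  + by case: (no u); split=> //; apply: conn_sym.
  + exact: U'conn.
Qed.

(* There are exactly [size U0] infinite components, and [U] meets them all. *)
Lemma covers_infc S U u : {subset B <= S} -> size U = size U0 -> covers S U ->
  u \in U -> infc S u.
Proof.
move=> BS sU SU uU; have [U' [sU' [uU' U'inf U'conn] _]] := indep_covers BS.
have /choice[h Hh] x : exists v, x \in U' -> v \in U /\ conn S x v.
  have [/U'inf/SU[v]|] := boolP (x \in U'); first by exists v.
  by exists x.
have uh : uniq (map h U').
  rewrite map_inj_in_uniq // => x y xU' yU' hxy; apply: U'conn => //.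
  apply: conn_trans (Hh _ xU').2 _; rewrite hxy.
  exact: conn_sym (Hh _ yU').2.
(* Since [h] is injective on [U'] and the sizes agree, every element of [U] is some [h x], hence
   lies in the infinite component of [x]. *)
have hU : {subset map h U' <= U} by move=> _ /mapP[x /Hh[? _] ->].
have [|_ E] := uniq_min_size uh hU; first by rewrite size_map sU sU'.
move: uU; rewrite -E => /mapP[x xU' ->].
by apply: infc_conn (Hh _ xU').2 _; apply: U'inf.
Qed.

Lemma ext_iff s z v : connected_graph G -> vertices G v -> v \in s ->
  (exists w, adj G z w /\ infc s w) <->
  exists S U X, {subset s <= S} /\ {subset B <= S} /\ size U = size U0 /\
    {subset S <= X} /\ frontier S U X /\
    exists w u, adj G z w /\ u \in U /\ conn s w u.
Proof.
move=> Gconn Vv vs; split=> [[w [zw winf]]|].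
  have BS : {subset B <= s ++ B} by move=> x; rewrite mem_cat orbC => ->.
  have sS : {subset s <= s ++ B} by move=> x; rewrite mem_cat => ->.
  have [U [sU _ SU]] := indep_covers BS.
  have [X [SX XU]] := covers_frontier SU.
  exists (s ++ B), U, X; do 5!split=> //.
  (* The infinite component of [w] off [s] contains one off [s ++ B], and [U] meets the latter. *)
  have [y [wy /SU[u [uU yu]]]] := infc_escape (s ++ B) winf.
  by exists w, u; do 2!split=> //; apply: conn_trans wy (conn_sub sS yu).
move=> [S [U [X [sS [BS [sU [SX [XU [w [u [zw [uU wu]]]]]]]]]]]].
exists w; split=> //; apply: infc_conn (conn_sym wu) _; apply: (infc_sub sS).
exact: covers_infc BS sU (frontier_covers Gconn Vv (sS _ vs) SX XU) uU.
Qed.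

End MaximalSeparator.

End Avoiding.

(** * Infinite simple paths *)

(** Bounded quantifiers over indices put simplicity in the form that [rec_tac] decides. *)
Lemma simple_pathE (T : eqType) (G : graph T) x0 (s : seq T) :
  simple_path G s <->
  0 < size s /\ vertices G (nth x0 s 0) /\
  (forall i, i < (size s).-1 -> adj G (nth x0 s i) (nth x0 s i.+1)) /\
  (forall i, i < size s -> forall j, j < i -> nth x0 s i <> nth x0 s j).
Proof.
case: s => [|x p] /=; first by split=> // -[].
split=> [[Vx /(pathP x0) xp up]|[_ [Vx [xp inj]]]].
  split=> //; split=> //; split=> // i ip j ji /eqP.
  rewrite (nth_uniq x0 (s := x :: p)) //=; last exact: ltn_trans ip.
  by rewrite gtn_eqF.
split=> //; first exact/(pathP x0).
rewrite -/(uniq (x :: p)); apply/(uniqP x0) => i j; rewrite !inE /= => ip jp ij.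
by case: (ltngtP i j) => // [/(inj j jp)|/(inj i ip)]; rewrite ij.
Qed.

(** Entries never change once present, and [s n] has more than [n] of them because [s 0] is
    nonempty, so the diagonal is the limit. *)
Lemma prefix_limit (T : eqType) (G : graph T) x0 (s : nat -> seq T) :
  (forall n, simple_path G (s n)) ->
  (forall n, exists w, s n.+1 = rcons (s n) w) ->
  let f i := nth x0 (s i) i in
  infinite_simple_path G f /\ mkseq f (size (s 0)) = s 0.
Proof.
move=> simp step f.
have s0 : 0 < size (s 0) by have /(simple_pathE _ x0)[] := simp 0.
have sizeE n : size (s n) = size (s 0) + n.
  elim: n => [|n IH]; first by rewrite addn0.
  by have [w ->] := step n; rewrite size_rcons IH addnS.
have lts i n : i <= n -> i < size (s n).
  move=> le_in; rewrite sizeE; apply: (@leq_ltn_trans n) => //.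
  by rewrite -[X in X < _]add0n ltn_add2r.
have stable i m d : i < size (s m) -> nth x0 (s (m + d)) i = nth x0 (s m) i.
  move=> im; elim: d => [|d IH]; first by rewrite addn0.
  rewrite addnS; have [w ->] := step (m + d).
  by rewrite nth_rcons IH sizeE addnA -sizeE ltn_addr.
have fE i n : i <= n -> f i = nth x0 (s n) i.
  by move=> le_in; rewrite -(subnKC le_in) stable //; apply: lts.
split; [split|].
- move=> n; rewrite (fE n n.+1) //.
  have /(simple_pathE _ x0)[_ [_ [h _]]] := simp n.+1; apply: h.
  by rewrite -ltnS prednK ?lts // (leq_trans _ (lts 0 n.+1 _)).
- have fneq i j : j < i -> f i <> f j.
    move=> ji; rewrite (fE j i); last exact: ltnW.
    by have /(simple_pathE _ x0)[_ [_ [_ h]]] := simp i; apply: h => //; apply: lts.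
  by move=> i j fij; case: (ltngtP i j) => // /fneq; rewrite fij.
- apply: (@eq_from_nth _ x0); first by rewrite size_mkseq.
  move=> i; rewrite size_mkseq => i0; rewrite nth_mkseq //.
  by rewrite /f -[i in s i]add0n stable.
Qed.

Lemma simple_path_rcons (T : eqType) (G : graph T) x0 (s : seq T) w :
  simple_path G s -> adj G (nth x0 s (size s).-1) w -> w \notin s ->
  simple_path G (rcons s w).
Proof.
case: s => [//|x p] [Vx xp up] lw ws; rewrite rcons_cons; split=> //.
  by rewrite rcons_path xp -[last x p]/(last x0 (x :: p)) -nth_last.
by rewrite -rcons_cons rcons_uniq ws.
Qed.

Lemma extendable_iff (T : choiceType) (G : graph T) (x0 : T) (s : seq T) :
  locally_finite G -> simple_path G s ->
  extendable_paths G s <->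
  exists w, adj G (nth x0 s (size s).-1) w /\ infc G s w.
Proof.
move=> Glf simp; split.
  move=> [_ [f [[fadj finj] fs]]].
  have s0 : 0 < size s by have /(simple_pathE _ x0)[] := simp.
  have sE i : i < size s -> nth x0 s i = f i by move=> ?; rewrite -fs nth_mkseq.
  exists (f (size s)); split.
    by rewrite sE ?prednK // -[in f (size s)](prednK s0).
  have fns i : f (size s + i) \notin s.
    apply/negP => /(nthP x0)[j js]; rewrite sE // => /finj jE.
    by move: js; rewrite jE ltnNge leq_addr.
  split; first by rewrite -[size s]addn0.
  (* The rest of the ray lies in one component off [s], which is infinite by injectivity of [f]. *)
  have fc i : conn G s (f (size s)) (f (size s + i)).
    elim: i => [|i IH]; first by rewrite addn0; apply: conn_refl; rewrite -[size s]addn0.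
    by apply: conn_step IH _ (fns _); rewrite addnS.
  apply: (@sub_infinite_set _ [set f (size s + i) | i in [set: nat]]).
    by move=> _ [i _ <-].
  suff /eq_finite_set E :
      ([set f (size s + i) | i in [set: nat]] #= [set: nat])%card.
    by rewrite /= E; apply: infinite_nat.
  by apply: inj_card_eq => i j _ _ /finj/addnI.
(* Conversely, [P] is an invariant that [infc_neighbor] preserves when the path is prolonged by [w];
   iterating yields a ray. *)
pose P s := simple_path G s /\ exists w, adj G (nth x0 s (size s).-1) w /\ infc G s w.
have Pstep t : exists w, P t -> P (rcons t w).
  have [[tsimp [w [lw winf]]]|] := pselect (P t); last by exists x0.
  exists w => _; split; first by apply: simple_path_rcons lw _ => //; case: winf.
  have [w' [ww' w'inf]] := infc_neighbor Glf winf; exists w'.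
  rewrite size_rcons nth_rcons ltnn eqxx; split=> //; apply: infc_sub w'inf.
  by move=> y; rewrite mem_rcons.
have [g Hg] := choice Pstep.
move=> sext; split=> //.
have PP n : P (iter n (fun t => rcons t (g t)) s).
  by elim: n => [|n IH]; [split | apply: Hg].
have [||fsimp fE] := @prefix_limit _ G x0 (fun n => iter n (fun t => rcons t (g t)) s).
- by move=> n; case: (PP n).
- by move=> n; exists (g (iter n (fun t => rcons t (g t)) s)).
by eexists; split; [exact: fsimp | exact: fE].
Qed.

(** * Highly computable graphs *)

Lemma sigma1_ex_seq k (P : seq nat -> env -> Prop) :
  sigma1 k.+1 (fun e => P (decode (e 0)) (shift e)) ->
  sigma1 k (fun e => exists s, P s e).
Proof.
move=> /(sigma1_ex (P := fun n => P (decode n))); apply: sigma1_ext => e.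
split=> [[n Pn]|[s Ps]]; first by exists (decode n).
by exists (code s); rewrite CodeSeq.codeK.
Qed.

Lemma sigma1_all_mem k N (P : nat -> env -> Prop) :
  total_rec k N -> sigma1 k.+1 (fun e => P (e 0) (shift e)) ->
  sigma1 k (fun e => forall x, x \in decode (N e) -> P x e).
Proof.
move=> HN HP.
apply: (@sigma1_ext _ (fun e => forall i, i < size (decode (N e)) ->
    P (nth 0 (decode (N e)) i) e)).
  move=> e; split=> h x; last by move=> xN; apply/h/mem_nth.
  by move=> /(nthP 0)[i iN <-]; apply: h.
apply: (@sigma1_all _ _ (fun i e => P (nth 0 (decode (N e)) i) e)).
  exact: rec_size.
apply: (sigma1_subst (H := fun i e => if i is j.+1 then e j.+1
  else nth 0 (decode (N (shift e))) (e 0))) HP _.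
case=> [|i] ik; last exact: rec_var.
by apply: rec_nth; [apply: rec_weaken | apply: rec_var].
Qed.

Lemma tup1 e : tup 1 e = [tuple e 0].
Proof. exact: val_inj. Qed.

Lemma tup2 e : tup 2 e = [tuple e 0; e 1].
Proof. exact: val_inj. Qed.

Lemma rec_search1 (P : nat -> nat -> Prop) :
  dec 2 (fun e => P (e 0) (e 1)) -> (forall x, exists n, P n x) ->
  exists f, total_rec 1 (fun e => f (e 0)) /\ forall x, P (f x) x.
Proof.
move=> HP ex; have [|F [[c Hc] PF]] := @rec_search 1 (fun n e => P n (e 0)) HP.
  by move=> e; apply: ex.
(* Formally [F] depends on the whole environment; it is read at a constant one, which agrees with
   [e] on the only variable that [c] sees. *)
exists (fun x => F (fun=> x)); split=> [|x]; last exact: (PF (fun=> x)).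
by exists c => e; have := Hc (fun=> e 0); rewrite !tup1.
Qed.

Lemma rec_computable_on k D f F : computable_on D f -> total_rec k F ->
  (forall e, D (F e)) -> total_rec k (fun e => f (F e)).
Proof.
move=> [c Hc] [d Hd] DF; exists (rec_comp c (fun=> d)) => e.
apply: (@eval_comp _ _ _ _ _ [tuple F e]); last exact/Hc/DF.
by move=> i; rewrite (ord1 i); apply: Hd.
Qed.

Lemma rec_count k (P : nat -> nat -> bool) F G :
  dec 2 (fun e => P (e 0) (e 1)) -> total_rec k F -> total_rec k G ->
  total_rec k (fun e => count (P (F e)) (iota 0 (G e))).
Proof.
move=> HP; apply: (rec_app2 (f := fun x m => count (P x) (iota 0 m))).
apply: (@rec_ext _ (fun e => iteri (e 1) (fun y z =>
    if `[< P (e 0) y >] then z.+1 else z) 0)).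
  move=> e; elim: (e 1) => [//|m IH].
  rewrite -[in RHS]addn1 iotaD count_cat /= IH !addn0 asboolb.
  by case: (P _ _); rewrite ?addn1 ?addn0.
apply: (rec_iteri (H := fun y z e => if `[< P (e 0) y >] then z.+1 else z)).
- exact: rec_var.
- apply: (@rec_if _ (fun e => P (e 2) (e 0))).
  + by apply: (dec_app2 (P := P)) HP _ _; apply: rec_var.
  + by apply: rec_S; apply: rec_var.
  + exact: rec_var.
- exact: rec_0.
Qed.

Section ComputableGraph.
Variable G : graph nat.
Hypothesis (Ghc : highly_computable G).

Let Glf : locally_finite G. Proof. by case: Ghc. Qed.

Lemma dec_vertices k F : total_rec k F -> dec k (fun e => vertices G (F e)).
Proof.
apply: (dec_app1 (P := vertices G)); case: Ghc => -[c Hc] _ _ _.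
by exists c => e; rewrite tup1; apply: Hc.
Qed.

Lemma dec_adj k F F' : total_rec k F -> total_rec k F' ->
  dec k (fun e => adj G (F e) (F' e)).
Proof.
apply: (dec_app2 (P := adj G)); case: Ghc => _ [c Hc] _ _.
by exists c => e; rewrite tup2 asboolb; apply: Hc.
Qed.

Lemma count_degree x : vertices G x ->
  exists m, count (adj G x) (iota 0 m) = degree G x.
Proof.
move=> Vx; set X := fset_set (neighbors G x).
exists (\max_(y <- X) y).+1; rewrite -size_filter; apply: perm_size.
apply: uniq_perm; rewrite ?filter_uniq ?iota_uniq ?fset_uniq // => y.
rewrite mem_filter mem_iota /= add0n ltnS in_fset_set; last exact: Glf.
rewrite -[LHS]andbC; apply/andP/idP => [[_ xy]|]; first by rewrite inE.
rewrite inE /neighbors /= => xy; split=> //.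
by apply: (leq_bigmax_seq (F := id)); rewrite // in_fset_set ?inE //; apply: Glf.
Qed.

(** When as many neighbors lie below [m] as the degree allows, none is left above. *)
Lemma neighbor_lt x y m : count (adj G x) (iota 0 m) = degree G x ->
  adj G x y -> y < m.
Proof.
move=> E xy; have [Vx _] := adj_vertices xy; have lfx := Glf Vx.
have [|||_ F] := @uniq_min_size _ [seq z <- iota 0 m | adj G x z]
    (fset_set (neighbors G x)).
- by rewrite filter_uniq // iota_uniq.
- by move=> z; rewrite mem_filter in_fset_set // inE => /andP[].
- by rewrite size_filter E.
have : y \in fset_set (neighbors G x) by rewrite in_fset_set // inE.
by rewrite -F mem_filter mem_iota add0n => /and3P[].
Qed.

(** Search for an [m] below which the number of neighbors reaches the computable degree. *)
Lemma neighbor_bound :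
  exists nb, total_rec 1 (fun e => nb (e 0)) /\ forall x y, adj G x y -> y < nb x.
Proof.
have [[x0 Vx0]|noV] := pselect (exists x, vertices G x); last first.
  exists id; split=> [|x y /adj_vertices[Vx]]; first exact: rec_var.
  by case: noV; exists x.
(* The degree is computable on vertices only, so any other number is replaced by a fixed vertex. *)
pose r x := if `[< vertices G x >] then x else x0.
have Vr x : vertices G (r x) by rewrite /r; case: asboolP.
have Hr k F : total_rec k F -> total_rec k (fun e => r (F e)).
  by move=> HF; apply: (rec_if (P := fun e => vertices G (F e))) => //;
    [apply: dec_vertices | apply: rec_const].
have [||nb [Hnb nbE]] := @rec_search1 (fun m x =>
    count (adj G (r x)) (iota 0 m) = degree G (r x)).
- apply: dec_eq.
    apply: (rec_count (P := adj G)); last exact: rec_var.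
      by apply: dec_adj; apply: rec_var.
    by apply: Hr; apply: rec_var.
  case: Ghc => _ _ _ Hdeg; apply: rec_computable_on Hdeg _ _ => //.
  by apply: Hr; apply: rec_var.
- by move=> x; apply: count_degree.
exists nb; split=> // x y xy; apply: neighbor_lt (xy); have := nbE x.
by rewrite {1 2}/r asboolT //; case: (adj_vertices xy).
Qed.

(** [neighbor_bound] turns the quantifier over neighbors into a bounded one. *)
Lemma sigma1_all_adj k F (P : nat -> env -> Prop) :
  total_rec k F -> sigma1 k.+1 (fun e => P (e 0) (shift e)) ->
  sigma1 k (fun e => forall y, adj G (F e) y -> P y e).
Proof.
move=> HF HP; have [nb [Hnb nbP]] := neighbor_bound.
apply: (@sigma1_ext _ (fun e => forall y, y < nb (F e) ->
    ~ adj G (F e) y \/ P y e)).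
  move=> e; split=> h y xy; first by case: (h y (nbP _ _ xy)).
  by have [/h|] := pselect (adj G (F e) y); [right | left].
apply: (@sigma1_all _ _ (fun y e => ~ adj G (F e) y \/ P y e)).
  exact: rec_app1 Hnb HF.
apply: sigma1_or => //; apply/dec_sigma1/dec_not/dec_adj; last exact: rec_var.
exact: rec_weaken.
Qed.

End ComputableGraph.

Ltac rec_hook ::= first
  [ apply: rec_nth | apply: rec_size | apply: dec_mem
  | match goal with H : highly_computable _ |- _ =>
      first [apply: (dec_adj H) | apply: (dec_vertices H)] end ].

Lemma dec_simple_path G k N : highly_computable G -> total_rec k N ->
  dec k (fun e => simple_path G (decode (N e))).
Proof.
move=> Ghc; apply: (dec_app1 (P := fun n => simple_path G (decode n))).
apply: dec_ext (fun e => iff_sym (simple_pathE G 0 (decode (e 0)))) _.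
rec_tac.
Qed.

Lemma sigma1_conn G k F F' F'' : highly_computable G ->
  total_rec k F -> total_rec k F' -> total_rec k F'' ->
  sigma1 k (fun e => conn G (decode (F e)) (F' e) (F'' e)).
Proof.
move=> Ghc; apply: (sigma1_app3 (P := fun n => conn G (decode n))).
apply: (@sigma1_ext _ (fun e => exists q, 0 < size q /\ nth 0 q 0 = e 1 /\
    nth 0 q (size q).-1 = e 2 /\
    (forall i, i < (size q).-1 -> adj G (nth 0 q i) (nth 0 q i.+1)) /\
    (forall i, i < size q -> ~ nth 0 q i \in decode (e 0)))).
  move=> e; split=> [[q]|[p [xp pS pl]]].
    case: q => [[]//|x p] /= [_ [<- [pl [xp pS]]]].
    exists p; split; first exact/(pathP 0).
      by apply/(all_nthP 0) => i /pS/negP.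
    by rewrite -pl (nth_last 0 (x :: p)).
  exists (e 1 :: p); split=> //; split=> //; split.
    by rewrite (nth_last 0 (e 1 :: p)).
  by split=> [|i ip]; [apply/pathP | apply/negP; apply: (all_nthP 0 pS)].
apply: sigma1_ex_seq; apply: dec_sigma1; rec_tac.
Qed.

Ltac sigma_tac :=
  cbv beta delta [shift];
  first
  [ solve [apply: dec_sigma1; rec_tac]
  | apply: sigma1_and; sigma_tac | apply: sigma1_or; sigma_tac
  | apply: sigma1_ex_seq; sigma_tac | apply: sigma1_ex; sigma_tac
  | apply: sigma1_all_mem; [rec_tac | sigma_tac]
  | match goal with H : highly_computable _ |- _ =>
      first [ apply: (sigma1_all_adj H); [rec_tac | sigma_tac]
            | apply: (sigma1_conn H); rec_tac ] end ].

Lemma dec_extendable G k : connected_graph G -> highly_computable G ->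
  ends_bound G k -> dec 1 (fun e => extendable_paths G (decode (e 0))).
Proof.
move=> Gconn Ghc Gk; have Glf : locally_finite G by case: Ghc.
have [B [U0 [BU0 U0max]]] := max_indep Glf Gk.
(* The constant [B] is written as a decoded number, so that quantifying over its members fits
   [sigma1_all_mem]. *)
rewrite -[B]CodeSeq.codeK in BU0.
pose lst n := nth 0 (decode n) (size (decode n)).-1.
have simp0 n : simple_path G (decode n) ->
    vertices G (nth 0 (decode n) 0) /\ nth 0 (decode n) 0 \in decode n.
  by move=> /(simple_pathE _ 0)[n0 [Vn _]]; split=> //; apply: mem_nth.
apply: post_dec.
  apply: (@sigma1_ext _ (fun e => simple_path G (decode (e 0)) /\
    exists S U X : seq nat, {subset decode (e 0) <= S} /\
      {subset decode (code B) <= S} /\ size U = size U0 /\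
      {subset S <= X} /\ frontier G S U X /\
      exists w u, adj G (lst (e 0)) w /\ u \in U /\ conn G (decode (e 0)) w u)).
    move=> e; split=> [[simp]|[simp ext]].
      have [Vv vs] := simp0 _ simp.
      by rewrite -(ext_iff Glf BU0 U0max _ Gconn Vv vs) (extendable_iff 0).
    split=> //; have [Vv vs] := simp0 _ simp.
    by rewrite -(ext_iff Glf BU0 U0max _ Gconn Vv vs) -(extendable_iff 0).
  cbv beta delta [frontier sub_mem lst].
  apply: sigma1_and; first by apply/dec_sigma1/dec_simple_path => //; apply: rec_var.
  sigma_tac.
(* The complement: either the word is not a simple path, which is decidable, or a finite closed [X]
   traps every continuation. *)
apply: (@sigma1_ext _ (fun e => ~ simple_path G (decode (e 0)) \/
  exists X : seq nat,
   (forall w, adj G (lst (e 0)) w -> w \in decode (e 0) \/ w \in X) /\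
   forall x, x \in X -> forall y, adj G x y -> y \in decode (e 0) \/ y \in X)).
  move=> e; rewrite -not_ext //.
  have [simp|nsimp] := pselect (simple_path G (decode (e 0))); last first.
    by split=> [_ []//|_]; left.
  by rewrite (extendable_iff 0) //; split=> [[]//|]; right.
apply: sigma1_or; last by cbv delta [lst]; sigma_tac.
by apply/dec_sigma1/dec_not/dec_simple_path => //; apply: rec_var.
Qed.

Lemma extendable_singleton (T : choiceType) (G : graph T) :
  connected_graph G -> locally_finite G -> infinite_set (vertices G) ->
  exists x, extendable_paths G [:: x].
Proof.
move=> Gconn Glf Ginf.
have [x Vx] : vertices G !=set0.
  by apply/set0P/eqP => V0; apply: Ginf; rewrite V0.
(* With nothing removed, the component of [x] contains all vertices by connectedness. *)
have xinf : infc G [::] x.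
  split=> //; apply: sub_infinite_set Ginf => y Vy.
  by have [p [xp py]] := Gconn x y Vx Vy; exists p; split=> //; apply/allP.
exists x; apply/(extendable_iff x) => //.
by have [w [xw winf]] := infc_neighbor Glf xinf; exists w.
Qed.

Lemma extendable_rcons (T : eqType) (G : graph T) (s : seq T) :
  extendable_paths G s -> exists w, extendable_paths G (rcons s w).
Proof.
move=> [simp [f [fsimp fs]]]; exists (f (size s)).
have E : mkseq f (size s).+1 = rcons s (f (size s)).
  by rewrite -[in RHS]fs size_mkseq -map_rcons /mkseq -addn1 iotaD add0n cats1.
split; last by exists f; rewrite size_rcons.
case: fsimp => fadj finj; have s0 : 0 < size s by case: (s) simp.
apply: (simple_path_rcons (x0 := f 0)) => //.
  rewrite -[X in nth _ X]fs nth_mkseq ?prednK //.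
  by rewrite -[X in adj _ _ (f X)](prednK s0).
apply/negP; rewrite -{2}fs => /mapP[i]; rewrite mem_iota => /andP[_ +] /finj E'.
by rewrite -E' add0n ltnn.
Qed.

(* Minimization finds one more vertex of an extendable path, and iterating this
   computes a ray. *)
Lemma computable_ray G : highly_computable G ->
  dec 1 (fun e => extendable_paths G (decode (e 0))) ->
  (exists x, extendable_paths G [:: x]) ->
  exists f : nat -> nat, infinite_simple_path G f /\ computable f.
Proof.
move=> Ghc HE [x Ex].
have HE' k F : total_rec k F -> dec k (fun e => extendable_paths G (decode (F e))).
  exact: (dec_app1 (P := fun n => extendable_paths G (decode n))).
(* The first alternative makes the search total; the other says through sizes and entries that [t]
   codes an extendable one-vertex prolongation. *)
have [||st [Hst stP]] := @rec_search1 (fun t n =>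
  ~ extendable_paths G (decode n) \/
  extendable_paths G (decode t) /\
  size (decode t) = (size (decode n)).+1 /\
  forall i, i < size (decode n) -> nth 0 (decode t) i = nth 0 (decode n) i).
- apply: dec_or; first by apply/dec_not/HE'; rec_tac.
  by apply: dec_and; [apply/HE'; rec_tac | rec_tac].
- move=> n; have [En|nEn] := pselect (extendable_paths G (decode n)); last first.
    by exists 0; left.
  have [w Ew] := extendable_rcons En; exists (code (rcons (decode n) w)); right.
  rewrite CodeSeq.codeK size_rcons; do 2!split=> //.
  by move=> i i_n; rewrite nth_rcons i_n.
pose p n := iteri n (fun _ z => st z) (code [:: x]).
have Ep n : extendable_paths G (decode (p n)).
  elim: n => [|n IH]; first by rewrite -[[:: x]]CodeSeq.codeK in Ex.
  by rewrite /p /=; case: (stP (p n)) => [//|[]].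
have [||fsimp _] := @prefix_limit _ G 0 (fun n => decode (p n)).
- by move=> n; case: (Ep n).
- move=> n; case: (stP (p n)) => [|[_ [sz eqn]]]; first by case; apply: Ep.
  exists (nth 0 (decode (p n.+1)) (size (decode (p n)))).
  apply: (@eq_from_nth _ 0); first by rewrite size_rcons -sz.
  move=> i; rewrite [X in _ < X]sz ltnS leq_eqVlt nth_rcons => /predU1P[->|i_n].
    by rewrite ltnn eqxx.
  by rewrite i_n; apply: eqn.
exists (fun i => nth 0 (decode (p i)) i); split=> //.
have [c Hc] : total_rec 1 (fun e => nth 0 (decode (p (e 0))) (e 0)).
  apply: rec_nth; last exact: rec_var.
  apply: (rec_iteri (H := fun _ z _ => st z)); [exact: rec_var| |exact: rec_const].
  by apply: (rec_app1 (f := st)) Hst _; apply: rec_var.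
by exists c => n _; have := Hc (fun=> n); rewrite tup1.
Qed.

Theorem theorem3p9 (G : graph nat) (Gconn : connected_graph G)
    (Ghc : highly_computable G) (Ginf : infinite_set (vertices G))
    (Gends : finitely_many_ends G) :
  decidable_words (extendable_paths G) /\
  exists f : nat -> nat, infinite_simple_path G f /\ computable f.
Proof.
have [k [Gk _]] := Gends; have HE := dec_extendable Gconn Ghc Gk.
split; last first.
  apply: computable_ray => //; apply: extendable_singleton => //.
  by case: Ghc.
have [c Hc] := HE; exists c => n _.
by have := Hc (fun=> n); rewrite tup1.
Qed.
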